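(* Let $\varphi(x)$ be a first-order formula in one free variable over (the first-order counterpart of) a modal signature. The following are equivalent: (i) $\varphi$ is invariant under graded bisimulation $\sim_{\mathrm{C}}$ within the class of all finite pointed Kripke structures over the modal signature of $\varphi$, i.e. whenever $\mathcal{M},w$ and $\mathcal{M}',w'$ are finite and $\mathcal{M},w\sim_{\mathrm{C}}\mathcal{M}',w'$ then $\mathcal{M}\models\varphi[w]\iff\mathcal{M}'\models\varphi[w']$; (ii) there is a formula $\varphi'$ of graded modal logic $\mathrm{CML}$ such that $\varphi$ and $\varphi'$ are equivalent over all finite pointed Kripke structures over this signature.
   Context: A modal signature consists of a finite set $I$ of agents and a finite set $J$ of basic propositions. A Kripke structure is $\mathcal{M}=(W,(E_i)_{i\in I},(P_j)_{j\in J})$ with $W\neq\emptyset$, $E_i\subseteq W\times W$, $P_j\subseteq W$, viewed as a relational structure with binary relations $E_i$ and unary relations $P_j$; it is finite if $W$ is finite. A pointed Kripke structure $\mathcal{M},w$ has a distinguished world $w$, and $\varphi(x)$ is evaluated by assigning $w$ to $x$. $E_i[u]=\{v:(u,v)\in E_i\}$. Graded modal logic $\mathrm{CML}$: formulae built from propositional letters $p_j$, $\top$, using $\neg,\wedge,\vee$ and graded modalities $\langle k\rangle_i\psi$ ($i\in I$, $k\ge1$), with $\mathcal{M},w\models\langle k\rangle_i\psi$ iff $|\{u\in E_i[w]:\mathcal{M},u\models\psi\}|\geq k$. A graded bisimulation between $\mathcal{M}$ and $\mathcal{M}'=(W',(E'_i),(P'_j))$ is a non-empty relation $Z\subseteq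 W\times W'$ such that for all $(u,u')\in Z$: (atom equivalence) $u\in P_j\iff u'\in P'_j$ for all $j$; (graded forth) for every $i$ and $k\ge1$ and pairwise distinct $v_1,\dots,v_k\in E_i[u]$ there are pairwise distinct $v'_1,\dots,v'_k\in E'_i[u']$ with $(v_m,v'_m)\in Z$ for all $m$; (graded back) symmetrically, for pairwise distinct $v'_1,\dots,v'_k\in E'_i[u']$ there are pairwise distinct $v_1,\dots,v_k\in E_i[u]$ with $(v_m,v'_m)\in Z$. $\mathcal{M},w\sim_{\mathrm{C}}\mathcal{M}',w'$ if such $Z$ exists with $(w,w')\in Z$. *)

(* Defs.v *)
From mathcomp Require Import all_boot.
Set Implicit Arguments. Unset Strict Implicit. Unset Printing Implicit Defensive.

(** Finite Kripke structures: carrier a finType (hence finite). Non-emptiness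
    is automatic for pointed structures (the distinguished world). *)
Record kripke (I J : Type) := Kripke {
  world :> finType;
  kedge : I -> rel world;
  kprop : J -> pred world
}.
Arguments kedge {I J} k i.
Arguments kprop {I J} k j.

Inductive fo (I J : Type) : Type :=
| FEq  : nat -> nat -> fo I J
| FE   : I -> nat -> nat -> fo I J
| FP   : J -> nat -> fo I J
| FTop : fo I J
| FNeg : fo I J -> fo I J
| FAnd : fo I J -> fo I J -> fo I J
| FOr  : fo I J -> fo I J -> fo I J
| FEx  : nat -> fo I J -> fo I J
| FAll : nat -> fo I J -> fo I J.

Fixpoint fo_free (I J : Type) (v : nat) (phi : fo I J) : bool :=
  match phi with
  | FEq x y => (v == x) || (v == y)
  | FE _ x y => (v == x) || (v == y)
  | FP _ x => v == x
  | FTop => false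
  | FNeg p => fo_free v p
  | FAnd p q => fo_free v p || fo_free v q
  | FOr p q => fo_free v p || fo_free v q
  | FEx x p => (v != x) && fo_free v p
  | FAll x p => (v != x) && fo_free v p
  end.

Definition one_free_var (I J : Type) (x : nat) (phi : fo I J) : Prop :=
  forall v, fo_free v phi -> v = x.

Definition upd (W : Type) (a : nat -> W) (x : nat) (d : W) : nat -> W :=
  fun y => if y == x then d else a y.

Fixpoint fo_sat (I J : Type) (M : kripke I J) (a : nat -> M) (phi : fo I J)
  : Prop :=
  match phi with
  | FEq x y => a x = a y
  | FE i x y => kedge M i (a x) (a y)
  | FP j x => kprop M j (a x)
  | FTop => True
  | FNeg p => ~ @fo_sat _ _ M a p
  | FAnd p q => @fo_sat _ _ M a p /\ @fo_sat _ _ M a q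
  | FOr p q => @fo_sat _ _ M a p \/ @fo_sat _ _ M a q
  | FEx x p => exists d : M, @fo_sat _ _ M (upd a x d) p
  | FAll x p => forall d : M, @fo_sat _ _ M (upd a x d) p
  end.

Arguments fo_sat {I J} M a phi.

(** M |= phi[w] for phi with the single free variable x: x is assigned w
    (all other variables are also sent to w, which is irrelevant). *)
Definition fo_holds_at (I J : Type) (x : nat) (phi : fo I J)
  (M : kripke I J) (w : M) : Prop := fo_sat M (fun _ => w) phi.

(** Graded modal logic CML. [CDia i k psi] stands for <k.+1>_i psi,
    i.e. the grade k.+1 >= 1 (grades are positive by construction). *)
Inductive cml (I J : Type) : Type :=
| CP   : J -> cml I J
| CTop : cml I J
| CNeg : cml I J -> cml I J
| CAnd : cml I J -> cml I J -> cml I J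
| COr  : cml I J -> cml I J -> cml I J
| CDia : I -> nat -> cml I J -> cml I J.

Fixpoint cml_sat (I J : Type) (M : kripke I J) (w : M) (psi : cml I J)
  : bool :=
  match psi with
  | CP j => kprop M j w
  | CTop => true
  | CNeg p => ~~ @cml_sat _ _ M w p
  | CAnd p q => @cml_sat _ _ M w p && @cml_sat _ _ M w q
  | COr p q => @cml_sat _ _ M w p || @cml_sat _ _ M w q
  | CDia i k p => k.+1 <= #|[pred u | kedge M i w u && @cml_sat _ _ M u p]|
  end.

Arguments cml_sat {I J} M w psi.

(** Graded bisimulation. Pairwise distinct v_1..v_k are encoded as an
    injective map 'I_k -> world. *)
Definition graded_bisim (I J : Type) (M M' : kripke I J)
  (Z : M -> M' -> Prop) : Prop :=
  (exists u u', Z u u') /\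
  forall u u', Z u u' ->
    (forall j, kprop M j u = kprop M' j u') /\
    (forall i (k : nat), 0 < k ->
       forall f : 'I_k -> M, injective f -> (forall m, kedge M i u (f m)) ->
       exists g : 'I_k -> M', injective g /\
         forall m, kedge M' i u' (g m) /\ Z (f m) (g m)) /\
    (forall i (k : nat), 0 < k ->
       forall g : 'I_k -> M', injective g -> (forall m, kedge M' i u' (g m)) ->
       exists f : 'I_k -> M, injective f /\
         forall m, kedge M i u (f m) /\ Z (f m) (g m)).

Definition graded_bisimilar (I J : Type) (M : kripke I J) (w : M)
  (M' : kripke I J) (w' : M') : Prop :=
  exists Z : M -> M' -> Prop, graded_bisim Z /\ Z w w'.

(* Main.v *)
Require Import Defs.
From mathcomp Require Import all_boot.
From mathcomp Require Import zify.
From Stdlib Require Import Classical_Prop.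
Set Implicit Arguments. Unset Strict Implicit. Unset Printing Implicit Defensive.

(** Unravel [M, w] into the tree of walks from [w] of length at most [l], and let
    the leaves continue into a copy of [M]: the result is graded bisimilar to
    [M, w].  For [l] exponential in the quantifier rank [q] of the invariant formula,
    the part beyond the tree can be cut off: adding disjoint copies does not change
    the graded bisimulation type, and inside [q + 1] copies of the disjoint union of
    the unravelling and the bare tree, both roots look alike in the [q]-round game,
    since their [l]-neighbourhoods are isomorphic and distant moves are answered in a
    fresh copy.  Two trees of depth [l] whose graded types agree up to grade
    [q * l + 1] are in turn indistinguishable in [q] rounds, so the formula depends
    only on such a type.  There are finitely many types, each defined by a CML
    formula. *)

(** * Invariance of CML under graded bisimulation *)

Lemma leq_card_injP (T : finType) (A : pred T) (k : nat) :
  k <= #|A| <-> exists f : 'I_k -> T, injective f /\ forall m, A (f m).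
Proof.
split=> [leA|[f [f_inj fA]]].
  exists (fun m => enum_val (widen_ord leA m)); split=> [m n|m].
    by move/enum_val_inj/(congr1 val) => /= /val_inj.
  exact: (enum_valP (widen_ord leA m)).
rewrite -[k]card_ord -(card_codom f_inj); apply/subset_leq_card/subsetP=> y.
by case/codomP=> m ->; apply: fA.
Qed.

Section Kripke.
Variables I J : finType.
Implicit Types M K A B C : kripke I J.

Lemma graded_bisim_cml M M' (Z : M -> M' -> Prop) (psi : cml I J) :
  graded_bisim Z -> forall u u', Z u u' -> cml_sat M u psi = cml_sat M' u' psi.
Proof.
case=> _ bisZ; elim: psi => //=.
- by move=> j u u' /bisZ[+ _].
- by move=> p IHp u u' /IHp->.
- by move=> p IHp r IHr u u' Zu; rewrite (IHp _ _ Zu) (IHr _ _ Zu).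
- by move=> p IHp r IHr u u' Zu; rewrite (IHp _ _ Zu) (IHr _ _ Zu).
move=> i k p IHp u u' Zu; case: (bisZ u u' Zu) => _ [forth back].
apply/idP/idP=> /leq_card_injP[f [f_inj /(_ _)/andP fP]].
  have [m|g [g_inj gP]] := forth i k.+1 isT f f_inj; first by case: (fP m).
  apply/leq_card_injP; exists g; split=> // m.
  by case: (gP m) => /= -> /IHp <-; case: (fP m).
have [m|g [g_inj gP]] := back i k.+1 isT f f_inj; first by case: (fP m).
apply/leq_card_injP; exists g; split=> // m.
by case: (gP m) => /= -> /IHp ->; case: (fP m).
Qed.

(** * Graded bisimulations from maps that are bijective on successors *)

(** The functional form of a graded bisimulation: [h] restricts to a bijection between the
    successors of [u] and those of [h u]. Predecessors are unconstrained, so inclusions of disjoint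
    summands qualify. *)
Definition locally_bijective M M' (h : M -> M') : Prop :=
  [/\ forall j u, kprop M' j (h u) = kprop M j u,
      forall i u v, kedge M i u v -> kedge M' i (h u) (h v),
      forall i u v', kedge M' i (h u) v' -> exists v, kedge M i u v /\ h v = v'
    & forall i u v1 v2, kedge M i u v1 -> kedge M i u v2 ->
        h v1 = h v2 -> v1 = v2].

Lemma locally_bijective_bisimilar M M' (h : M -> M') (w : M) :
  locally_bijective h -> graded_bisimilar w (h w).
Proof.
case=> hP hE hlift hinj; exists (fun u u' => h u = u'); split=> //.
split=> [|u _ <-]; first by exists w, (h w).
split=> [j|]; first by rewrite hP.
split=> i k _ f f_inj fE.
  exists (h \o f); split=> [m n /hinj fmn|m /=]; last by split=> //; apply: hE.
  by apply/f_inj/(fmn i u).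
have /fin_all_exists[g gP]: forall m, exists v, kedge M i u v /\ h v = f m.
  by move=> m; apply: hlift.
exists g; split=> // m n eq_g; apply: f_inj.
by case: (gP m) (gP n) => _ <- [_ <-]; rewrite eq_g.
Qed.

Definition disjoint_union M K : kripke I J :=
  @Kripke I J (M + K)%type
    (fun i u v => match u, v with
      | inl a, inl b => kedge M i a b
      | inr a, inr b => kedge K i a b
      | _, _ => false end)
    (fun j u => match u with inl a => kprop M j a | inr a => kprop K j a end).

Lemma inl_locally_bijective M K :
  @locally_bijective M (disjoint_union M K) inl.
Proof.
split=> // [i u [v|//] uv|i u v1 v2 _ _ [//]]; by exists v.
Qed.

Lemma inr_locally_bijective M K :
  @locally_bijective K (disjoint_union M K) inr.
Proof.
split=> // [i u [//|v] uv|i u v1 v2 _ _ [//]]; by exists v.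
Qed.

Definition copies (n : nat) K : kripke I J :=
  @Kripke I J ('I_n * K)%type
    (fun i u v => (u.1 == v.1) && kedge K i u.2 v.2)
    (fun j u => kprop K j u.2).

Lemma copies_locally_bijective n K :
  @locally_bijective (copies n K) K snd.
Proof.
split=> //= [i u v /andP[] //|i [t u] v uv|].
  by exists (t, v); rewrite /= eqxx.
by move=> i u [t1 v1] [t2 v2] /= /andP[/eqP<- _] /andP[/eqP<- _] ->.
Qed.

(** * Ehrenfeucht-Fraisse games and Gaifman balls *)

Fixpoint qrank (phi : fo I J) : nat :=
  match phi with
  | FNeg p => qrank p
  | FAnd p q | FOr p q => maxn (qrank p) (qrank q)
  | FEx _ p | FAll _ p => (qrank p).+1
  | _ => 0
  end.

Lemma upd_mem (A B : eqType) (a : nat -> A) (b : nat -> B) (s : seq (A * B)) x d e :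
  (forall v, (a v, b v) \in s) ->
  forall v, (upd a x d v, upd b x e v) \in (d, e) :: s.
Proof.
by move=> ab v; rewrite /upd inE; case: (v == x); rewrite ?eqxx ?ab ?orbT.
Qed.

Section BackAndForth.
Variables (A B : kripke I J) (R : nat -> seq (A * B) -> Prop).
Hypothesis R_eq : forall k s, R k s -> forall x y, x \in s -> y \in s ->
  (x.1 == y.1) = (x.2 == y.2).
Hypothesis R_edge : forall k s, R k s -> forall i x y, x \in s -> y \in s ->
  kedge A i x.1 y.1 = kedge B i x.2 y.2.
Hypothesis R_prop : forall k s, R k s -> forall j x, x \in s ->
  kprop A j x.1 = kprop B j x.2.
Hypothesis R_forth : forall k s, R k.+1 s -> forall a, exists b, R k ((a, b) :: s).
Hypothesis R_back : forall k s, R k.+1 s -> forall b, exists a, R k ((a, b) :: s).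

(** In [R k s], [s] lists the pairs played so far and [k] counts the rounds left. Variables only
    have to point to pairs in [s], so requantifying a variable adds a pair and never removes one. *)
Lemma back_and_forth phi k s (a : nat -> A) (b : nat -> B) :
  qrank phi <= k -> R k s -> (forall v, (a v, b v) \in s) ->
  fo_sat A a phi <-> fo_sat B b phi.
Proof.
elim: phi k s a b => /=.
- move=> x y k s a b _ Rs ab; have := R_eq Rs (ab x) (ab y).
  by move=> /= eqs; split=> /eqP; [rewrite eqs|rewrite -eqs] => /eqP.
- by move=> i x y k s a b _ Rs ab; rewrite (R_edge Rs i (ab x) (ab y)).
- by move=> j x k s a b _ Rs ab; rewrite (R_prop Rs j (ab x)).
- by [].
- by move=> p IHp k s a b pk Rs ab; have := IHp _ _ _ _ pk Rs ab; tauto.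
- move=> p IHp q IHq k s a b; rewrite geq_max => /andP[pk qk] Rs ab.
  by have := IHp _ _ _ _ pk Rs ab; have := IHq _ _ _ _ qk Rs ab; tauto.
- move=> p IHp q IHq k s a b; rewrite geq_max => /andP[pk qk] Rs ab.
  by have := IHp _ _ _ _ pk Rs ab; have := IHq _ _ _ _ qk Rs ab; tauto.
- move=> x p IHp [//|k] s a b pk Rs ab; split=> [[d Hd]|[e He]].
    have [e Re] := R_forth Rs d; exists e.
    exact/(IHp _ _ _ _ pk Re (upd_mem x d e ab)).
  have [d Rd] := R_back Rs e; exists d.
  exact/(IHp _ _ _ _ pk Rd (upd_mem x d e ab)).
move=> x p IHp [//|k] s a b pk Rs ab; split=> H d.
  have [e Re] := R_back Rs d.
  exact/(IHp _ _ _ _ pk Re (upd_mem x e d ab)).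
have [e Re] := R_forth Rs d.
exact/(IHp _ _ _ _ pk Re (upd_mem x d e ab)).
Qed.
End BackAndForth.

(** * Balls in the Gaifman graph, which ignores agents and directions *)

Definition adjacent K (u v : K) :=
  [exists i, kedge K i u v || kedge K i v u].

Lemma adjacent_sym K : symmetric (@adjacent K).
Proof. by move=> u v; apply: eq_existsb => i; rewrite orbC. Qed.

Definition neighbours K (X : {set K}) : {set K} :=
  X :|: [set v | [exists u in X, adjacent u v]].

Definition ball K n (X : {set K}) : {set K} := iter n (@neighbours K) X.

Lemma neighboursP K (X : {set K}) v :
  reflect (v \in X \/ exists2 u, u \in X & adjacent u v) (v \in neighbours X).
Proof.
rewrite !inE; apply: (iffP orP) => -[Xv|]; [by left| |by left|].
  by case/exists_inP=> u Xu uv; right; exists u.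
by case=> u Xu uv; right; apply/exists_inP; exists u.
Qed.

Lemma neighboursS K (X Y : {set K}) :
  X \subset Y -> neighbours X \subset neighbours Y.
Proof.
move/subsetP=> XY; apply/subsetP=> v /neighboursP[Xv|[u Xu uv]]; apply/neighboursP.
  by left; apply: XY.
by right; exists u => //; apply: XY.
Qed.

Lemma ballS K n (X Y : {set K}) : X \subset Y -> ball n X \subset ball n Y.
Proof. by move=> XY; elim: n => //= n; apply: neighboursS. Qed.

Lemma ballD K m n (X : {set K}) : ball m (ball n X) = ball (m + n) X.
Proof. by rewrite /ball iterD. Qed.

Lemma subset_ball K m n (X : {set K}) : m <= n -> ball m X \subset ball n X.
Proof.
move=> /subnK <-; rewrite -ballD; elim: (n - m) => //= k IH.
exact: subset_trans IH (subsetUl _ _).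
Qed.

Lemma ballU K n (X Y : {set K}) : ball n (X :|: Y) = ball n X :|: ball n Y.
Proof.
elim: n => //= n; rewrite /ball /= => ->; apply/setP=> v; rewrite in_setU.
apply/neighboursP/orP => [[|[u]]|].
- by rewrite in_setU => /orP[Xv|Yv]; [left|right]; apply/neighboursP; left.
- rewrite in_setU => /orP[Xv|Yv] uv; [left|right]; apply/neighboursP; right;
    by exists u.
- by case=> /neighboursP[Xv|[u Xu uv]]; 
    [left|right; exists u => //|left|right; exists u => //]; rewrite in_setU ?Xv ?Xu ?orbT.
Qed.

Lemma ball_sym K n (x y : K) : (x \in ball n [set y]) = (y \in ball n [set x]).
Proof.
have imp m (u v : K) : u \in ball m [set v] -> v \in ball m [set u].
  elim: m u v => [|m IH] u v; first by rewrite !inE eq_sym.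
  case/neighboursP=> [/IH|[z /IH zv zu]].
    exact/subsetP/subset_ball.
  suff: ball m [set z] \subset ball m.+1 [set u] by move/subsetP; apply.
  rewrite -addn1 -ballD; apply: ballS; rewrite sub1set; apply/neighboursP.
  by right; exists u; rewrite ?set11 // adjacent_sym.
by apply/idP/idP; apply: imp.
Qed.

(** Otherwise [a] would reach [z] in [r] steps, [x] in one more and [X] in another [r]. *)
Lemma ball_separated K r (X : {set K}) (a x z : K) :
  a \notin ball (2 * r + 1) X -> x \in ball r X -> z \in ball r [set a] ->
  z \notin neighbours [set x].
Proof.
move=> aX xX za; apply: contra aX => zx.
suff: ball r [set z] \subset ball (2 * r + 1) X.
  by move/subsetP; apply; rewrite ball_sym.
have ->: 2 * r + 1 = r + (1 + r) by lia.
rewrite -2!ballD; apply: ballS; rewrite sub1set.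
by move: zx; apply/subsetP/neighboursS; rewrite sub1set.
Qed.

(** An isomorphism of induced substructures with its inverse, both given as total maps whose values
    outside [X] and [Y] are irrelevant. *)
Definition local_iso A B (f : A -> B) (g : B -> A) (X : {set A}) (Y : {set B}) :=
  [/\ forall x, x \in X -> f x \in Y /\ g (f x) = x,
      forall y, y \in Y -> g y \in X /\ f (g y) = y,
      forall j x, x \in X -> kprop B j (f x) = kprop A j x
    & forall i x z, x \in X -> z \in X -> kedge B i (f x) (f z) = kedge A i x z].

Lemma local_iso_sym A B (f : A -> B) g X Y :
  local_iso f g X Y -> local_iso g f Y X.
Proof.
case=> fX gY fP fE; split=> // [j y Yy|i y z Yy Yz].
  by case: (gY y Yy) => Xy {2}<-; rewrite fP.
by case: (gY y Yy) (gY z Yz) => Xy {2}<- [Xz {2}<-]; rewrite fE.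
Qed.

Lemma local_iso_image_ball A B (f : A -> B) g X Y n (X0 : {set A}) (Y0 : {set B}) :
  local_iso f g X Y -> ball n X0 \subset X ->
  (forall x, x \in X0 -> f x \in Y0) ->
  forall x, x \in ball n X0 -> f x \in ball n Y0.
Proof.
case=> _ _ _ fE; elim: n => [|n IH] sX fX0 //= x.
have sXn := subset_trans (subset_ball X0 (leqnSn n)) sX.
move=> xn; case/neighboursP: (xn) => [/(IH sXn fX0)|[u un ux]] /=.
  by move=> ?; apply/neighboursP; left.
apply/neighboursP; right; exists (f u); first exact: IH.
case/existsP: ux => i ux; apply/existsP; exists i.
by rewrite !fE // ?(subsetP sX x xn) ?(subsetP sXn u un).
Qed.

Lemma local_iso_ball A B (f : A -> B) g X Y n (X0 : {set A}) (Y0 : {set B}) :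
  local_iso f g X Y -> ball n X0 \subset X -> ball n Y0 \subset Y ->
  (forall x, x \in X0 -> f x \in Y0) -> (forall y, y \in Y0 -> g y \in X0) ->
  local_iso f g (ball n X0) (ball n Y0).
Proof.
move=> fg sX sY fX0 gY0; have gf := local_iso_sym fg.
have fb := local_iso_image_ball fg sX fX0.
have gb := local_iso_image_ball gf sY gY0.
move/subsetP in sX; move/subsetP in sY.
case: fg => fX gY fP fE; split=> [x xn|y yn|j x /sX/fP //|i x z /sX Xx /sX Xz].
- by split; [apply: fb|case: (fX x (sX _ xn))].
- by split; [apply: gb|case: (gY y (sY _ yn))].
- exact: fE.
Qed.

(** The two domains are disjoint with no edge between them, and so are the two ranges; hence gluing
    creates no new edge to compare. *)
Lemma local_isoU A B (f f' : A -> B) (g g' : B -> A) (X X' : {set A}) (Y Y' : {set B}) :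
  local_iso f g X Y -> local_iso f' g' X' Y' ->
  (forall x z, x \in X -> z \in X' -> z \notin neighbours [set x]) ->
  (forall x z, x \in Y -> z \in Y' -> z \notin neighbours [set x]) ->
  local_iso (fun x => if x \in X then f x else f' x)
            (fun y => if y \in Y then g y else g' y) (X :|: X') (Y :|: Y').
Proof.
have apart C (U V : {set C}) :
    (forall x z, x \in U -> z \in V -> z \notin neighbours [set x]) ->
    (forall z, z \in V -> z \in U = false) /\ 
    (forall i x z, x \in U -> z \in V ->
       kedge C i x z = false /\ kedge C i z x = false).
  move=> UV; split=> [z Vz|i x z Ux Vz].
    by apply/negP=> Uz; have /neighboursP[] := UV z z Uz Vz; left; rewrite set11.
  have /neighboursP xz := UV x z Ux Vz.
  by split; apply/negP=> e; apply: xz; right; exists x; rewrite ?set11 //;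
    apply/existsP; exists i; rewrite e ?orbT.
move=> fg fg' /apart[XX' XE] /apart[YY' YE].
case: fg fg' => fX gY fP fE [fX' gY' fP' fE']; split.
- move=> x /setUP[Xx|X'x].
    by rewrite Xx; case: (fX x Xx) => Yf gf; rewrite in_setU Yf.
  by rewrite XX' //; case: (fX' x X'x) => Yf gf; rewrite in_setU Yf orbT YY'.
- move=> y /setUP[Yy|Y'y].
    by rewrite Yy; case: (gY y Yy) => Xg fg; rewrite in_setU Xg.
  by rewrite YY' //; case: (gY' y Y'y) => Xg fg; rewrite in_setU Xg orbT XX'.
- by move=> j x /setUP[Xx|X'x]; [rewrite Xx fP|rewrite XX' // fP'].
move=> i x z /setUP[Xx|X'x] /setUP[Xz|X'z].
- by rewrite Xx Xz fE.
- rewrite Xx XX' //; case: (XE i x z Xx X'z) => -> _.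
  by case: (YE i _ _ (proj1 (fX x Xx)) (proj1 (fX' z X'z))) => ->.
- rewrite Xz XX' //; case: (XE i z x Xz X'x) => _ ->.
  by case: (YE i _ _ (proj1 (fX z Xz)) (proj1 (fX' x X'x))) => _ ->.
- by rewrite !XX' // fE'.
Qed.

(** With [r = radius m], a point within [2 * r + 1] of the old points has its [r]-ball inside their
    ball of radius [3 * r + 1]; the [r]-ball of a farther point neither meets nor touches the
    [r]-balls of the old ones. *)
Fixpoint radius k := if k is m.+1 then 3 * radius m + 1 else 0.

(** * The local game on disjoint copies *)

Section LocalGame.
Variables (n : nat) (K : kripke I J).
Let D := copies n K.

Lemma ball_copy m (X : {set D}) z : z \in ball m X -> exists2 x, x \in X & z.1 = x.1.
Proof.
elim: m z => [|m IH] z; first by exists z.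
case/neighboursP=> [/IH //|[u /IH[x Xx ux] uz]]; exists x => //; rewrite -ux.
by case/existsP: uz => i /orP[] /andP[/eqP].
Qed.

Lemma shift_local_iso m (t t' : 'I_n) (x : K) :
  local_iso (fun z : D => (t', z.2) : D) (fun z : D => (t, z.2) : D)
    (ball m [set ((t, x) : D)]) (ball m [set ((t', x) : D)]).
Proof.
have fg : local_iso (fun z : D => (t', z.2) : D) (fun z : D => (t, z.2) : D)
    [set z : D | z.1 == t] [set z : D | z.1 == t'].
  split=> //= [[s y]|[s y]|i [s y] [s' y']]; rewrite !inE /= ?eqxx.
  - by move/eqP->.
  - by move/eqP->.
  - by move=> /eqP-> /eqP->; rewrite eqxx.
apply: (local_iso_ball fg); last 2 first.
- by move=> z; rewrite !inE => /eqP->.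
- by move=> z; rewrite !inE => /eqP->.
- by apply/subsetP=> z /ball_copy[y]; rewrite !inE => /eqP-> ->.
- by apply/subsetP=> z /ball_copy[y]; rewrite !inE => /eqP-> ->.
Qed.

(** The bound [size s + k <= n] guarantees that an untouched copy remains as long as a round is
    left. *)
Definition local_position k (s : seq (D * D)) : Prop :=
  size s + k <= n /\ exists f g : D -> D,
    local_iso f g (ball (radius k) [set a in unzip1 s])
                  (ball (radius k) [set b in unzip2 s]) /\
    forall x, x \in s -> f x.1 = x.2 /\ g x.2 = x.1.

Definition flip (A B : Type) (s : seq (A * B)) := [seq (x.2, x.1) | x <- s].

Lemma local_position_flip k s : local_position k s -> local_position k (flip s).
Proof.
case=> sz [f [g [fg fgs]]]; split; first by rewrite size_map.
exists g, f; split; last by move=> x /mapP[y /fgs[? ?] ->].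
by rewrite /unzip1 /unzip2 /flip -!map_comp; apply: local_iso_sym.
Qed.

Lemma local_forth k s : local_position k.+1 s ->
  forall a, exists b, local_position k ((a, b) :: s).
Proof.
move=> [sz [f [g [fg fgs]]]] a; set r := radius k.
set X := [set a in unzip1 s] in fg *; set Y := [set b in unzip2 s] in fg *.
have X1 b : [set c in unzip1 ((a, b) :: s)] = X :|: [set a].
  by apply/setP=> c; rewrite !inE orbC.
have Y1 b : [set c in unzip2 ((a, b) :: s)] = Y :|: [set b].
  by apply/setP=> c; rewrite !inE orbC.
have fX x : x \in X -> f x \in Y.
  by rewrite !inE => /mapP[y ys ->]; rewrite (proj1 (fgs y ys)) map_f.
have gY x : x \in Y -> g x \in X.
  by rewrite !inE => /mapP[y ys ->]; rewrite (proj2 (fgs y ys)) map_f.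
have sz1 b : size ((a, b) :: s) + k <= n by rewrite addSnnS.
have le_r m : m <= 2 * r + 1 -> r + m <= radius k.+1 by rewrite /= -/r; lia.
have le_r' m : m <= 2 * r + 1 -> m <= radius k.+1 by rewrite /= -/r; lia.
have gf := local_iso_sym fg.
(* Near move: the old isomorphism already covers the [r]-ball of [a], so [f a] is the answer and
   [f], [g] are kept. *)
have [aX|aX] := boolP (a \in ball (2 * r + 1) X).
  have fa : f a \in ball (2 * r + 1) Y.
    by apply: (local_iso_image_ball fg) fX _ aX; apply/subset_ball/le_r'.
  have gfa : g (f a) = a.
    case: fg => /(_ a) + _ _ _; case=> //.
    by apply: (subsetP (subset_ball _ _)) aX; apply: le_r'.
  exists (f a); split=> //; exists f, g; rewrite X1 Y1; split; last first.
    by move=> x; rewrite inE => /orP[/eqP->|/fgs].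
  apply: (local_iso_ball fg); last 2 first.
  - by move=> x; rewrite !in_setU !in_set1 => /orP[/fX->|/eqP->]; rewrite ?eqxx ?orbT.
  - by move=> x; rewrite !in_setU !in_set1 => /orP[/gY->|/eqP->]; rewrite ?gfa ?eqxx ?orbT.
  - rewrite ballU subUset (subset_ball _ (le_r' r _)) /=; last by lia.
    apply: (@subset_trans _ _ (ball (r + (2 * r + 1)) X)); last exact/subset_ball/le_r.
    by rewrite -ballD; apply: ballS; rewrite sub1set.
  - rewrite ballU subUset (subset_ball _ (le_r' r _)) /=; last by lia.
    apply: (@subset_trans _ _ (ball (r + (2 * r + 1)) Y)); last exact/subset_ball/le_r.
    by rewrite -ballD; apply: ballS; rewrite sub1set.
(* Far move: the answers so far occupy at most [size s < n] copies, so the same point of [K] can be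
   played in an untouched copy [t']. *)
have [t' t'P] : exists t', t' \notin [seq x.2.1 | x <- s].
  apply/existsP; rewrite -negb_forall; apply/negP=> /forallP all_s.
  have := @uniq_leq_size _ (enum 'I_n) [seq x.2.1 | x <- s] (enum_uniq _).
  rewrite size_enum_ord size_map => /(_ (fun t _ => all_s t)); rewrite leqNgt => /negP; apply.
  by apply: leq_trans sz; rewrite addnS ltnS leq_addr.
case: a => t x in X1 Y1 sz1 aX *; exists (t', x); split=> //.
have Yt' m z : z \in ball m Y -> z.1 != t'.
  case/ball_copy=> y + ->; rewrite inE => /mapP[p ps ->].
  by apply: contra t'P => /eqP<-; apply: (map_f (fun x => x.2.1)).
have fgr : local_iso f g (ball r X) (ball r Y).
  by apply: (local_iso_ball fg) => //; apply/subset_ball/le_r'; lia.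
have Yfar : (t', x) \notin ball (2 * r + 1) Y.
  by apply/negP=> /Yt'; rewrite eqxx.
(* The new maps come from [local_isoU]: the old ones near the old points, and the change of copy
   index elsewhere. *)
rewrite X1 Y1 !ballU; eexists; eexists; split.
  apply: (local_isoU fgr (shift_local_iso r t t' x)).
  - by move=> y z; apply: ball_separated.
  - by move=> y z; apply: ball_separated.
have notin_r (Z : {set D}) z : z \notin ball (2 * r + 1) Z -> (z \in ball r Z) = false.
  move=> zZ; apply/negbTE; apply: contra zZ; apply/subsetP/subset_ball; lia.
move=> y; rewrite inE => /orP[/eqP->|ys].
  by rewrite /= (notin_r _ _ aX) (notin_r _ _ Yfar).
have yX : y.1 \in ball r X.
  by apply: (subsetP (subset_ball X (leq0n r))); rewrite inE map_f.
have yY : y.2 \in ball r Y.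
  by apply: (subsetP (subset_ball Y (leq0n r))); rewrite inE map_f.
by rewrite yX yY; apply: fgs.
Qed.

Lemma local_equivalence phi q (a b : D) (f g : D -> D) :
  qrank phi <= q -> q < n -> f a = b -> g b = a ->
  local_iso f g (ball (radius q) [set a]) (ball (radius q) [set b]) ->
  fo_sat D (fun=> a) phi <-> fo_sat D (fun=> b) phi.
Proof.
move=> phiq qn fa gb fg.
apply: (@back_and_forth D D local_position _ _ _ _ _ phi q [:: (a, b)]) => //.
- move=> k s [_ [f' [g' [_ fgs]]]] x y /fgs[fx gx] /fgs[fy gy].
  by apply/eqP/eqP => e; [rewrite -fx -fy e|rewrite -gx -gy e].
- move=> k s [_ [f' [g' [[_ _ _ fE] fgs]]]] i x y xs ys.
  case: (fgs x xs) (fgs y ys) => <- _ [<- _]; rewrite fE //.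
    by apply: (subsetP (subset_ball _ (leq0n _))); rewrite inE map_f.
  by apply: (subsetP (subset_ball _ (leq0n _))); rewrite inE map_f.
- move=> k s [_ [f' [g' [[_ _ fP _] fgs]]]] j x xs.
  case: (fgs x xs) => <- _; rewrite fP //.
  by apply: (subsetP (subset_ball _ (leq0n _))); rewrite inE map_f.
- exact: local_forth.
- move=> k s /local_position_flip Rs c; have [d Rd] := local_forth Rs c.
  exists d; move/local_position_flip: Rd; rewrite /flip /= -map_comp /=.
  by rewrite (@map_id_in _ _ s) //; case.
- split=> //; exists f, g; split=> [|x]; last by rewrite inE => /eqP->.
  have set_seq1 c : [set d in [:: c]] = [set c] :> {set D}.
    by apply/setP=> d; rewrite !inE.
  by rewrite !set_seq1.
- by move=> v; rewrite inE.
Qed.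
End LocalGame.

(** * Bounded unravellings *)

Section Unravelling.
Variables (l : nat) (M : kripke I J) (w : M).
Implicit Types s p : seq (I * M).

(* Walks from [w] are stored in reverse: the head is the last step. *)
Definition endpoint s : M := if s is x :: _ then x.2 else w.

Fixpoint walk s : bool :=
  if s is x :: p then kedge M x.1 (endpoint p) x.2 && walk p else true.

Definition child_of (i : I) p s : bool :=
  if s is x :: p' then (x.1 == i) && (p' == p) else false.

(** The length bound makes the carrier finite. Each step records its agent, so a world reached
    through two agents yields two children. *)
Definition bounded_walk := {s : {bseq l of (I * M)} | walk s}.
Definition steps (u : bounded_walk) : seq (I * M) := val (val u).

Definition tree : kripke I J :=
  @Kripke I J bounded_walk (fun i u v => child_of i (steps u) (steps v))
    (fun j u => kprop M j (endpoint (steps u))).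

(** Walks of full length [l] continue into [M] instead of stopping, so every node keeps all
    successors of its endpoint although the structure is finite. *)
Definition unravelling : kripke I J :=
  @Kripke I J (bounded_walk + M)%type
    (fun i u v => match u, v with
      | inl a, inl b => child_of i (steps a) (steps b)
      | inl a, inr b => (size (steps a) == l) && kedge M i (endpoint (steps a)) b
      | inr a, inr b => kedge M i a b
      | inr _, inl _ => false end)
    (fun j u => match u with
      | inl a => kprop M j (endpoint (steps a))
      | inr a => kprop M j a end).

Lemma size_steps u : size (steps u) <= l.
Proof. exact: size_bseq. Qed.

Lemma walk_steps u : walk (steps u).
Proof. exact: (valP u). Qed.

Lemma steps_inj : injective steps.
Proof. by move=> u v /val_inj/val_inj. Qed.

Lemma bounded_walk_of s : size s <= l -> walk s -> {u : bounded_walk | steps u = s}.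
Proof.
move=> sl sw; exists (exist (fun b : {bseq l of (I * M)} => walk b) (Bseq sl) sw).
by [].
Qed.

Definition root : bounded_walk := sval (@bounded_walk_of [::] isT isT).

Lemma steps_root : steps root = [::].
Proof. by rewrite /root; case: bounded_walk_of. Qed.

Definition project (u : unravelling) : M :=
  match u with inl a => endpoint (steps a) | inr a => a end.

Lemma project_locally_bijective : locally_bijective project.
Proof.
split=> [j [a|a] //|i [a|a] [b|b] //=|i [a|a] v /= av|i [a|a] [b|b] [c|c] //=].
- have := walk_steps b; case: (steps b) => [//|x p] /= /andP[e _].
  by case/andP=> /eqP<- /eqP<-.
- by case/andP.
- have [la|la] := leqP l (size (steps a)).
    by exists (inr v); rewrite /= eqn_leq la size_steps.
  have [|b sb] := @bounded_walk_of ((i, v) :: steps a) la; first by rewrite /= av walk_steps.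
  by exists (inl b); rewrite /= sb /= !eqxx.
- by exists (inr v).
- case sb: (steps b) => [//|[j x] p]; case sc: (steps c) => [//|[k y] p'] /=.
  move=> /andP[/eqP ej /eqP ep] /andP[/eqP ek /eqP ep'] exy.
  by congr inl; apply: steps_inj; rewrite sb sc ej ep ek ep' exy.
(* Successors of both kinds cannot coexist: a node with successors in [M] has length [l], and a
   child walk would be longer. *)
- have := size_steps b; case: (steps b) => [//|x p] /= lt_l /andP[_ /eqP pa].
  by case/andP=> /eqP al; rewrite pa al ltnn in lt_l.
- have := size_steps c; case: (steps c) => [|x p] /= lt_l /andP[/eqP al _] //.
  by case/andP=> _ /eqP pa; rewrite pa al ltnn in lt_l.
- by move=> _ _ ->.
- by move=> _ _ ->.
Qed.

(** * Cutting the unravelling down to its tree part *)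

Section Truncate.
Variables (n : nat) (t : 'I_n).
Let U := disjoint_union unravelling tree.
Let D := copies n U.

(** An involution exchanging the tree part of the unravelling with the bare tree; its value on the
    copy of [M] is a default. *)
Definition mirror (z : U) : U :=
  match z with
  | inl (inl s) => inr s
  | inr s => inl (inl s)
  | inl (inr m) => inl (inr m)
  end.

Definition in_unravelled (z : U) := if z is inl (inl _) then true else false.
Definition in_tree (z : U) := if z is inr _ then true else false.

Lemma mirror_local_iso :
  @local_iso D D (fun z => (z.1, mirror z.2)) (fun z => (z.1, mirror z.2))
    [set z : D | in_unravelled z.2] [set z : D | in_tree z.2].
Proof.
split.
- by move=> [s [[a|a]|a]]; rewrite !inE.
- by move=> [s [[a|a]|a]]; rewrite !inE.
- by move=> j [s [[a|a]|a]]; rewrite !inE.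
- by move=> i [s [[a|a]|a]] [s' [[b|b]|b]]; rewrite !inE.
Qed.

(** A Gaifman step changes the depth by at most one, and only walks of length [l] have edges into
    [M], so [l] steps from the root cannot leave the tree part. *)
Lemma ball_unravelled m z : m <= l ->
  z \in ball m [set ((t, inl (inl root)) : D)] ->
  exists2 a, z.2 = inl (inl a) & size (steps a) <= m.
Proof.
elim: m z => [|m IH] z ml.
  by rewrite inE => /eqP-> /=; exists root; rewrite ?steps_root.
case/neighboursP=> [/(IH _ (ltnW ml))[a -> am]|[u /(IH _ (ltnW ml))[a ua am]]].
  by exists a => //; apply: leqW.
case/existsP=> i; rewrite /= ua; case: z => s [[b|b]|b] /=; rewrite ?andbF //.
- move=> ab; exists b => //; case/orP: ab => /andP[_]; rewrite /child_of.
    by case: (steps b) => // x p /andP[_ /eqP->].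
  by case: (steps a) am => // x p /= pm /andP[_ /eqP<-]; apply: leqW (ltnW pm).
- by rewrite orbF => /and3P[_ /eqP al _]; rewrite al leqNgt ml in am.
Qed.

Lemma ball_tree m z : z \in ball m [set ((t, inr root) : D)] -> in_tree z.2.
Proof.
elim: m z => [|m IH] z; first by rewrite inE => /eqP->.
case/neighboursP=> [/IH //|[[s u] /IH ut]].
by case/existsP=> i; case: u z ut => [[u|u]|u] [s' [[z|z]|z]] //=; rewrite !andbF.
Qed.
End Truncate.

Lemma tree_equivalence phi q :
  (forall (M1 M2 : kripke I J) (w1 : M1) (w2 : M2), graded_bisimilar w1 w2 ->
     fo_sat M1 (fun=> w1) phi <-> fo_sat M2 (fun=> w2) phi) ->
  qrank phi <= q -> radius q <= l ->
  fo_sat M (fun=> w) phi <-> fo_sat tree (fun=> root) phi.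
Proof.
move=> inv phiq ql.
(* Both roots are placed in one structure, with one copy for the starting point and one for each of
   the [q] rounds. *)
set U := disjoint_union unravelling tree; set D := copies q.+1 U.
pose a : D := (ord0, inl (inl root)); pose b : D := (ord0, inr root).
have aw : fo_sat D (fun=> a) phi <-> fo_sat M (fun=> w) phi.
  have lbi := @inl_locally_bijective unravelling tree.
  have := inv _ _ _ _ (locally_bijective_bisimilar a (@copies_locally_bijective q.+1 U)).
  have := inv _ _ _ _ (locally_bijective_bisimilar (inl root : unravelling) lbi).
  have := inv _ _ _ _ (locally_bijective_bisimilar (inl root : unravelling) project_locally_bijective).
  by rewrite /= steps_root /=; tauto.
have bw : fo_sat D (fun=> b) phi <-> fo_sat tree (fun=> root) phi.
  have lbi := @inr_locally_bijective unravelling tree.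
  have := inv _ _ _ _ (locally_bijective_bisimilar b (@copies_locally_bijective q.+1 U)).
  by have := inv _ _ _ _ (locally_bijective_bisimilar (root : tree) lbi); rewrite /=; tauto.
rewrite -aw -bw.
pose f (z : D) : D := (z.1, mirror z.2).
apply: (@local_equivalence q.+1 U phi q a b f f) => //.
apply: (local_iso_ball (@mirror_local_iso q.+1)).
- by apply/subsetP=> z /(ball_unravelled ql)[c zc _]; rewrite inE zc.
- by apply/subsetP=> z /ball_tree; rewrite inE.
- by move=> z; rewrite !inE => /eqP->.
- by move=> z; rewrite !inE => /eqP->.
Qed.

End Unravelling.

(** * Graded types and the game on trees *)

Section GradedTypes.
Variable c : nat.

(** Beyond the atoms, a type stores for each agent and each type one level down the number of such
    successors capped at [c], as the bits [k < count] for [k < c]. The cap keeps the set of types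
    finite. *)
Fixpoint gtype (d : nat) : finType :=
  if d is m.+1
  then ({ffun J -> bool} * {ffun I * gtype m * 'I_c -> bool})%type : finType
  else {ffun J -> bool} : finType.

Fixpoint type_of M (d : nat) (u : M) : gtype d :=
  match d return gtype d with
  | 0 => [ffun j => kprop M j u]
  | m.+1 => ([ffun j => kprop M j u],
      [ffun x : I * gtype m * 'I_c => x.2 < #|[pred v | kedge M x.1.1 u v && (type_of m v == x.1.2)]|])
  end.

Lemma type_of_prop M M' d (u : M) (u' : M') j :
  type_of d u = type_of d u' -> kprop M j u = kprop M' j u'.
Proof. by case: d => [|d] => [|[]] /ffunP/(_ j); rewrite !ffunE. Qed.

Lemma type_of_count M M' d (u : M) (u' : M') i t k :
  type_of d.+1 u = type_of d.+1 u' -> k < c ->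
  (k < #|[pred v | kedge M i u v && (type_of d v == t)]|) =
  (k < #|[pred v | kedge M' i u' v && (type_of d v == t)]|).
Proof. by case=> _ /ffunP e kc; have := e (i, t, Ordinal kc); rewrite !ffunE. Qed.

(** * Graded types are definable in CML *)

Definition literal (b : bool) (psi : cml I J) := if b then psi else CNeg psi.

Lemma literal_sat M (w : M) b psi :
  cml_sat M w (literal b psi) = (cml_sat M w psi == b).
Proof. by case: b => /=; case: cml_sat. Qed.

Definition cml_conj (s : seq (cml I J)) := foldr (@CAnd I J) (CTop I J) s.

Lemma cml_conj_sat M (w : M) s : cml_sat M w (cml_conj s) = all (cml_sat M w) s.
Proof. by elim: s => //= p s ->. Qed.

Definition cml_disj (s : seq (cml I J)) := foldr (@COr I J) (CNeg (CTop I J)) s.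

Lemma cml_disj_sat M (w : M) s : cml_sat M w (cml_disj s) = has (cml_sat M w) s.
Proof. by elim: s => //= p s ->. Qed.

Lemma conj_literal_sat M (w : M) (T : finType) (g : T -> cml I J) (b : {ffun T -> bool}) :
  cml_sat M w (cml_conj [seq literal (b x) (g x) | x <- enum T]) =
  ([ffun x => cml_sat M w (g x)] == b).
Proof.
rewrite cml_conj_sat all_map; apply/allP/eqP => [H|<- x _ /=].
  apply/ffunP=> x; rewrite ffunE; apply/eqP; rewrite -literal_sat.
  by apply: H; rewrite mem_enum.
by rewrite literal_sat ffunE.
Qed.

Definition atoms_formula (b : {ffun J -> bool}) :=
  cml_conj [seq literal (b j) (CP I j) | j <- enum J].

(** [CDia i k] has grade [k.+1], so its truth value is exactly the stored bit [k < count]. *)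
Fixpoint type_formula (d : nat) : gtype d -> cml I J :=
  match d return gtype d -> cml I J with
  | 0 => fun t => atoms_formula t
  | m.+1 => fun t => CAnd (atoms_formula t.1)
      (cml_conj [seq literal (t.2 x) (CDia x.1.1 x.2 (type_formula x.1.2))
            | x <- enum ((I * gtype m * 'I_c)%type : finType)])
  end.

Lemma type_formula_sat M (w : M) d (t : gtype d) :
  cml_sat M w (type_formula t) = (type_of d w == t).
Proof.
elim: d t w => [|d IH] t w /=; first by rewrite conj_literal_sat.
rewrite !conj_literal_sat /= -pair_eqE /=; congr (_ && (_ == _)).
apply/ffunP=> x; rewrite !ffunE; congr (_ < _).
by apply: eq_card => v; rewrite !inE IH.
Qed.

(** The formula is the finite disjunction over the types realised in [Q]; excluded middle decides
    which types these are. *)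
Lemma type_invariant_definable d (Q : forall M, M -> Prop) :
  (forall M M' (w : M) (w' : M'), type_of d w = type_of d w' -> Q M w -> Q M' w') ->
  exists psi, forall M (w : M), Q M w <-> cml_sat M w psi.
Proof.
move=> Qinv.
have /fin_all_exists[b bP] : forall t : gtype d, exists b : bool,
    b <-> exists M (w : M), type_of d w = t /\ Q M w.
  by move=> t; case: (classic (exists M (w : M), type_of d w = t /\ Q M w)) => H;
    [exists true|exists false]; split.
exists (cml_disj [seq type_formula t | t <- enum (gtype d) & b t]) => M w.
rewrite cml_disj_sat has_map; split=> [Qw|/hasP[t]].
  apply/hasP; exists (type_of d w); last by rewrite /= type_formula_sat.
  by rewrite mem_filter mem_enum andbT; apply/bP; exists M, w.
rewrite mem_filter /= type_formula_sat => /andP[/bP[M' [w' [<- Qw']]] _] /eqP e.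
exact: Qinv (esym e) Qw'.
Qed.
End GradedTypes.

(** * The game on two trees whose roots have equal type *)

Section TreeGame.
Variables (c l : nat).

(* A matching of reversed walks closed under taking parents, hence a partial
   isomorphism between two subtrees that contain the roots. *)
Definition match_set M M' (w : M) (w' : M') (S : seq (seq (I * M) * seq (I * M'))) :=
  [/\ ([::], [::]) \in S,
      forall x, x \in S -> [/\ size x.1 <= l, walk w x.1, walk w' x.2 &
        type_of c (l - size x.1) (endpoint w x.1) =
        type_of c (l - size x.1) (endpoint w' x.2)],
      forall x, x \in S -> map fst x.1 = map fst x.2 /\
        (behead x.1, behead x.2) \in S
    & forall x y, x \in S -> y \in S -> (x.1 == y.1) = (x.2 == y.2)].

Lemma match_set_flip M M' (w : M) (w' : M') S :
  match_set w w' S -> match_set w' w (flip S).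
Proof.
have flipP (A B : eqType) (T : seq (A * B)) a b :
    ((a, b) \in flip T) = ((b, a) \in T).
  by apply/mapP/idP => [[[x y] xy [-> ->]]|ab]; last by exists (b, a).
case=> S0 Sok Sp Sinj; split; rewrite ?flipP //.
- move=> [x y]; rewrite flipP => /[dup] /Sp[/= /(congr1 size)] + _ /Sok[] /=.
  by rewrite !size_map => <-.
- by move=> [x y]; rewrite !flipP => /Sp[/= ? ?]; split.
- by move=> [x y] [x' y']; rewrite !flipP => xy xy'; rewrite /= (Sinj _ _ xy xy').
Qed.

(** Induction from the root along [s]: each unmatched node costs one pair and is sent to an
    unmatched child, with the same agent and type, of its parent's partner. Such a child exists
    while fewer than [c] pairs are in use. *)
Lemma match_set_extend M M' (w : M) (w' : M') S (s : seq (I * M)) :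
  match_set w w' S -> size s <= l -> walk w s -> size S + size s <= c ->
  exists S' s', [/\ match_set w w' S', {subset S <= S'}, (s, s') \in S'
    & size S' <= size S + size s].
Proof.
move=> mS; elim: s => [|[i v] p IH] /=.
  by move=> _ _ _; exists S, [::]; rewrite addn0; split=> //; case: mS.
move=> sl /andP[pv wp] Sc.
have [|S1 [p' [mS1 SS1 pS1 szS1]]] := IH (ltnW sl) wp; first by lia.
have [/mapP[[s s'] sS1 /= es]|vS1] := boolP ((i, v) :: p \in unzip1 S1).
  by exists S1, s'; rewrite es sS1; split=> //; rewrite addnS; apply: leqW.
have [S1_0 S1ok S1p S1inj] := mS1.
set d := l - size ((i, v) :: p); set t := type_of c d v.
(* The type of [p] is one level deeper than that of its child, so it counts children by their types
   of depth [d]. *)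
have ld : l - size p = d.+1 by rewrite /d /=; lia.
have [_ _ wp' /=] := S1ok _ pS1; rewrite ld => ptype.
set A := [pred u | kedge M i (endpoint w p) u && (type_of c d u == t)].
set A' := [pred u | kedge M' i (endpoint w' p') u && (type_of c d u == t)].
have Av : v \in A by rewrite !inE pv eqxx.
have [v' /andP[A'v' v'S1]] : exists v', (v' \in A') && ((i, v') :: p' \notin unzip2 S1).
  apply/existsP; rewrite -[X in is_true X]negbK negb_exists; apply/negP=> /forallP full.
  have inS1 u : u \in A' -> exists2 z, z \in S1 & z.2 = (i, u) :: p'.
    move=> A'u; have := full u; rewrite A'u /= negbK => /mapP[z zS1 ->].
    by exists z.
  have small : #|A'| <= size S1.
    rewrite cardE -(size_map (fun u => (i, u) :: p')) -(size_map snd S1).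
    apply: uniq_leq_size; first by rewrite map_inj_uniq ?enum_uniq // => x y [].
    move=> _ /mapP[u + ->]; rewrite mem_enum => /inS1[z zS1 <-].
    exact: map_f.
  (* If every suitable child of [p'] were matched, their partners would be fewer
     than the suitable children of [p], as [v] is unmatched; but that number is
     below the threshold [c], so the types of [p] and [p'] would differ. *)
  have /fin_all_exists[g gP] : forall u : M', exists v1 : M, u \in A' ->
      v1 \in [predD1 A & v] /\ ((i, v1) :: p, (i, u) :: p') \in S1.
    move=> u; case: (boolP (u \in A')) => [A'u|]; last by exists v.
    have [[z z'] zS1 /= ez] := inS1 u A'u; subst z'.
    have [/=] := S1p _ zS1; case: z zS1 => [//|[j v1] p1] zS1 [ej _] /= p1S1.
    (* Parents of matched nodes are matched, and [p'] is matched to [p] alone, so the partner is a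
       child of [p]. *)
    have := S1inj _ _ p1S1 pS1; rewrite /= eqxx => /eqP ep; rewrite ej ep in zS1.
    exists v1 => _; split=> //; rewrite !inE.
    have [_ /= /andP[-> _] _ e] := S1ok _ zS1.
    case/andP: A'u => _ /eqP <-; rewrite /d /= e eqxx !andbT.
    by apply: contra vS1 => /eqP <-; apply: (map_f fst) zS1.
  have cardA : #|A'| < #|A|.
    rewrite (cardD1 v) Av add1n ltnS.
    rewrite -(cardsE A') -(@card_in_imset _ _ g [set u in A']).
      apply: subset_leq_card; apply/subsetP=> y /imsetP[u]; rewrite inE => A'u ->.
      by case: (gP u A'u).
    move=> u1 u2; rewrite !inE => /gP[_ g1] /gP[_ g2] eg.
    by have := S1inj _ _ g1 g2; rewrite /= eg eqxx => /esym/eqP[].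
  have := @type_of_count c _ _ _ _ _ i t #|A'| ptype.
  by rewrite -/A -/A' cardA ltnn => /(_ ltac:(lia)).
exists (((i, v) :: p, (i, v') :: p') :: S1), ((i, v') :: p'); split.
- split.
  + by rewrite inE S1_0 orbT.
  + move=> x; rewrite inE => /orP[/eqP->|/S1ok //] /=; rewrite -/d.
    by case/andP: A'v' => /= -> /eqP ->; rewrite pv wp wp'; split.
  + move=> x; rewrite inE => /orP[/eqP->|/S1p[e xS1]] /=.
      by rewrite inE pS1 orbT; case: (S1p _ pS1) => /= ->.
    by rewrite inE xS1 orbT.
  + have new x : x \in S1 -> (x.1 == (i, v) :: p) = (x.2 == (i, v') :: p').
      move=> xS1; transitivity false; last apply/esym; apply/negP=> /eqP e.
        by move: vS1; rewrite -e map_f.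
      by move: v'S1; rewrite -e map_f.
    move=> x y; rewrite !inE => /orP[/eqP->|xS1] /orP[/eqP->|yS1] /=.
    * by rewrite !eqxx.
    * by rewrite eq_sym new // eq_sym.
    * exact: new.
    * exact: S1inj.
- by move=> x /SS1 xS1; rewrite inE xS1 orbT.
- by rewrite inE eqxx.
- by rewrite /= addnS.
Qed.

(** A round adds at most [l] pairs, one for each node on the path to the chosen walk; [k * l]
    reserves room for all remaining rounds. *)
Definition tree_position M M' (w : M) (w' : M') k (s : seq (tree l w * tree l w')) :=
  exists S, [/\ match_set w w' S, size S + k * l <= c
    & forall x, x \in s -> (steps x.1, steps x.2) \in S].

Lemma tree_position_flip M M' (w : M) (w' : M') k s :
  tree_position (w := w) (w' := w') k s -> tree_position (w := w') (w' := w) k (flip s).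
Proof.
case=> S [mS Sc sS]; exists (flip S); rewrite size_map; split=> //.
  exact: match_set_flip.
by move=> _ /mapP[x /sS xS ->]; apply: (map_f (fun x => (x.2, x.1)) xS).
Qed.

Lemma tree_forth M M' (w : M) (w' : M') k s :
  tree_position (w := w) (w' := w') k.+1 s ->
  forall a, exists b, tree_position k ((a, b) :: s).
Proof.
case=> S [mS Sc sS] a; have al := size_steps a.
have [|S' [p [mS' SS' apS' szS']]] := match_set_extend mS al (walk_steps a).
  by rewrite mulSn in Sc; lia.
have [_ S'ok S'p _] := mS'.
have [_ _ wp _] := S'ok _ apS'.
have pl : size p <= l.
  by case: (S'p _ apS') => /= /(congr1 size); rewrite !size_map => <- _.
have [b bp] := bounded_walk_of pl wp.
exists b, S'; split=> //; first by rewrite mulSn in Sc; lia.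
by move=> x; rewrite inE => /orP[/eqP->|/sS/SS' //]; rewrite /= bp.
Qed.

(** The game starts from the single pair of empty walks, hence the successor in the bound on [c]. *)
Lemma tree_type_equivalence M M' (w : M) (w' : M') phi :
  (qrank phi * l).+1 <= c -> type_of c l w = type_of c l w' ->
  fo_sat (tree l w) (fun=> root l w) phi <-> fo_sat (tree l w') (fun=> root l w') phi.
Proof.
move=> qc ww'.
apply: (@back_and_forth (tree l w) (tree l w') (@tree_position _ _ w w')
          _ _ _ _ _ phi (qrank phi) [:: (root l w, root l w')]) => //.
- move=> k s [S [[_ _ _ Sinj] _ sS]] x y /sS xS /sS yS.
  have := Sinj _ _ xS yS; rewrite /= => e.
  by apply/eqP/eqP=> E; apply: steps_inj; apply/eqP; [rewrite -e E|rewrite e E].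
(* An edge into [y] means that [x] is the parent of [y] and [i] its last agent; matching preserves
   both. *)
- move=> k s [S [[_ _ Sp Sinj] _ sS]] i x y /sS xS /sS yS /=.
  case: (Sp _ yS) => /=; case: (steps y.1) => [|a p]; case: (steps y.2) => [|b p'] //=.
  by case=> -> _ /Sinj /(_ xS) /= ->.
- move=> k s [S [[_ Sok _ _] _ sS]] j x /sS/Sok[_ _ _].
  exact: type_of_prop.
- exact: tree_forth.
- move=> k s /tree_position_flip Rs b; have [a Ra] := tree_forth Rs b.
  exists a; move/tree_position_flip: Ra; rewrite /flip /= -map_comp /=.
  by rewrite (@map_id_in _ _ s) //; case.
- exists [:: ([::], [::])]; split=> //.
  + split=> // [x|x|x y]; rewrite !inE => /eqP-> //=; first by rewrite subn0.
    by move/eqP->.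
  + by move=> x; rewrite inE => /eqP->; rewrite /= !steps_root.
- by move=> v; rewrite inE.
Qed.
End TreeGame.

End Kripke.

Theorem mainTheorem6 (I J : finType) (x : nat) (phi : fo I J)
  (hphi : one_free_var x phi) :
  (forall (M : kripke I J) (w : M) (M' : kripke I J) (w' : M'),
      graded_bisimilar w w' ->
      (fo_holds_at x phi w <-> fo_holds_at x phi w'))
  <->
  (exists psi : cml I J,
      forall (M : kripke I J) (w : M),
        fo_holds_at x phi w <-> cml_sat M w psi).
Proof.
split=> [inv|[psi psiP] M w M' w' [Z [bisZ Zw]]]; last first.
  by rewrite !psiP (graded_bisim_cml psi bisZ Zw).
(* The depth [l] is the radius that [q] rounds of the local game can explore, and the cap
   [(q * l).+1] used below is the budget of [q] rounds on trees of that depth. *)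
set q := qrank phi; set l := radius q.
have tree_eq (M : kripke I J) (w : M) : fo_holds_at x phi w <-> fo_sat (tree l w) (fun=> root l w) phi.
  apply: (@tree_equivalence _ _ l M w phi q) => // M1 M2 w1 w2; exact: inv.
apply: (@type_invariant_definable _ _ (q * l).+1 l) => M M' w w' ww'.
rewrite (tree_eq _ w) (tree_eq _ w').
by have [] := @tree_type_equivalence _ _ (q * l).+1 l _ _ w w' phi (leqnn _) ww'.
Qed.
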